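(* Let $p$ be a prime. There are at least $$\Big(\frac{12}{\pi^2}-1\Big)p+O\big(p^{3/4}(\log p)^{2^{3/2}+1}\big)$$ ordered pairs $(a,b)\in\mathbb{Z}^2\cap[1,\sqrt p]^2$ such that for any integer $c$, the linear congruence $ax+by\equiv c\pmod p$ has a nonzero solution with $|x|\le\sqrt p$ and $|y|\le\sqrt p$. The implied constant is absolute.
   Context: A nonzero solution means a pair of integers $(x,y)\ne(0,0)$ satisfying the congruence. *)

(* Defs.v *)
From HB Require Import structures.
From mathcomp Require Import all_boot all_order all_algebra finmap.
From mathcomp Require Import all_classical all_reals all_analysis.

Set Implicit Arguments.
Unset Strict Implicit.
Unset Printing Implicit Defensive.

Import Order.TTheory GRing.Theory Num.Theory.

Local Open Scope classical_set_scope.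
Local Open Scope ring_scope.

Definition has_small_solution (R : realType) (p : nat) (a b c : int) : Prop :=
  exists x y : int,
    [/\ (x, y) <> (0, 0),
        (a * x + b * y = c %[mod p])%Z,
        `|x%:~R : R| <= Num.sqrt p%:R
      & `|y%:~R : R| <= Num.sqrt p%:R].

Definition good_pairs (R : realType) (p : nat) : set (int * int) :=
  [set ab | [/\ 1 <= (ab.1%:~R : R) <= Num.sqrt (p%:R : R),
                1 <= (ab.2%:~R : R) <= Num.sqrt (p%:R : R)
              & forall c : int, has_small_solution R p ab.1 ab.2 c]].

(* [fset_set] returns the empty set on infinite sets, so finiteness is what
   makes [#|` fset_set (good_pairs R p)|] the number of good pairs. *)
Lemma finite_good_pairs (R : realType) (p : nat) :
  finite_set (good_pairs R p).
Proof.
pose f (ij : 'I_p.+1 * 'I_p.+1) : int * int := ((ij.1 : nat)%:Z, (ij.2 : nat)%:Z).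
apply: (@sub_finite_set _ _ (f @` setT)); last first.
  exact/finite_image/finite_finset.
have bnd (z : int) : 1 <= (z%:~R : R) <= Num.sqrt (p%:R : R) ->
    exists i : 'I_p.+1, (i : nat)%:Z = z.
  case/andP => z1 zp.
  have z0 : 0 <= z by rewrite -(ler0z R) (le_trans ler01).
  have : z%:~R <= p%:R :> R.
    have s0 : 0 <= Num.sqrt (p%:R : R) by exact: sqrtr_ge0.
    rewrite (le_trans zp)// -[leRHS]sqr_sqrtr ?ler0n// expr2.
    by rewrite ler_peMl// (le_trans z1).
  case: z z0 {z1 zp} => // n _.
  rewrite -pmulrn ler_nat -ltnS => np.
  by exists (Ordinal np).
move=> [a b] [/= /bnd[i <-] /bnd[j <-] _].
by exists (i, j).
Qed.

(* Main.v *)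
Require Import Defs.
From mathcomp Require Import all_boot all_order all_algebra finmap.
From mathcomp Require Import all_classical all_reals all_analysis.
From mathcomp Require Import zify ring lra.

Import Order.TTheory GRing.Theory Num.Theory.
Import numFieldNormedType.Exports.

(** The main term is weak enough for an elementary argument: it is at most
    [p / 4], because [pi ^ 2 >= 48 / 5], so good pairs of density 1/4 in the
    square [[1, sqrt p] ^ 2] suffice.

    Let [N] be the integer part of [sqrt p].  A coprime pair [(a, b)] is good
    whenever one entry, say [a], is at least [N / 2 + 1]: choosing [y] in
    [[0, a - 1]] with [b y] congruent to [c] modulo [a], the integer
    [x = (c - b y) / a] satisfies [|x| <= N] for every [0 <= c <= p / 2], and
    these [c] with their opposites represent all classes modulo [p]
    ([small_int_solution], [small_mod_solution]).

    At least half of the pairs in [[1, N] ^ 2] are coprime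
    ([card_coprime_pairs]): a non-coprime pair has a common divisor which is 2
    or odd and at least 3, and the sum of the inverse squares of these numbers
    is at most 1/2.  About a quarter of all pairs have both entries below
    [N / 2 + 1]; hence at least [p / 4 - 2 sqrt p] pairs are good
    ([quarter_lower_bound]). *)

(** * Solving the congruence in a small box *)

Section Congruence.
Local Open Scope ring_scope.

(** The solutions of [a x + b y = c] have [y] running through a residue class
    modulo [a].  The representative [0 <= y < a] subtracts from [c] at most
    [b (a - 1)], so that [x] stays above [- b], while [x <= c / a] keeps it
    below [N + 1]. *)
Lemma small_int_solution (N a b c : nat) :
  coprime a b -> (0 < a <= N)%N -> (0 < b <= N)%N -> (c < a * N.+1)%N ->
  exists x y : int, [/\ (x, y) <> (0, 0), a%:Z * x + b%:Z * y = c%:Z,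
                       `|x| <= N%:Z & `|y| <= N%:Z].
Proof.
move=> cop /andP[a0 aN] /andP[b0 bN] cN.
have [c0|c0] := posnP c.
  (* For [c = 0] the canonical [y] would give the zero solution. *)
  exists b%:Z, (- a%:Z); split; [|by rewrite c0; ring|lia|lia].
  by case=> b_eq0; lia.
have /coprimezP[[u v] /= uv] : coprimez a b by rewrite coprimezE.
(* [v] inverts [b] modulo [a], so [b y] is congruent to [c] modulo [a]. *)
pose y := ((c%:Z * v) %% a%:Z)%Z.
have y0 : 0 <= y by rewrite modz_ge0; lia.
have ya : y < a%:Z by have := @ltz_pmod (c%:Z * v) a%:Z; apply; lia.
have /dvdzP[x xE] : (a %| c%:Z - b%:Z * y)%Z.
  apply/dvdzP; exists (c%:Z * u + b%:Z * (c%:Z * v %/ a%:Z)%Z).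
  have yE := divz_eq (c%:Z * v) a%:Z; rewrite -/y in yE.
  have cE : c%:Z = c%:Z * u * a%:Z + (c%:Z * v) * b%:Z.
    by rewrite -[LHS]mulr1 -uv; ring.
  by rewrite {1}cE {1}yE; ring.
have xyE : a%:Z * x + b%:Z * y = c%:Z by rewrite mulrC -xE; ring.
exists x, y; split=> //; last 2 first.
- rewrite ler_norml; apply/andP; split; rewrite leNgt; apply/negP => hx.
    nia.
  nia.
- lia.
by case=> x_eq0 y_eq0; move: xyE; rewrite x_eq0 y_eq0; lia.
Qed.

(** Every class modulo [p] has a representative of absolute value at most
    [p / 2], and the box of admissible [(x, y)] is symmetric, so it suffices to
    solve the equation over the integers for [0 <= c <= p / 2].  The previous
    lemma does so as soon as [p / 2 < a (N + 1)], which is what the lower bound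
    on [a] guarantees: [2 a (N + 1) >= (N + 2) (N + 1)] exceeds [(N + 1) ^ 2]. *)
Lemma small_mod_solution (p N a b : nat) (c : int) :
  coprime a b -> (N.+2 <= a.*2)%N -> (a <= N)%N -> (0 < b <= N)%N ->
  (0 < p < N.+1 ^ 2)%N ->
  exists x y : int, [/\ (x, y) <> (0, 0), (a%:Z * x + b%:Z * y = c %[mod p])%Z,
                       `|x| <= N%:Z & `|y| <= N%:Z].
Proof.
move=> cop Na aN bN /andP[p0 pN].
have aN' : (0 < a <= N)%N by lia.
have half_range : (p < (a * N.+1).*2)%N by nia.
pose r := (c %% p)%Z.
have r0 : 0 <= r by rewrite modz_ge0; lia.
have rp : r < p%:Z by have := @ltz_pmod c p%:Z; apply; lia.
have rE : (r = c %[mod p])%Z by rewrite modz_mod.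
have [r_small|r_large] := leP (r *+ 2) p%:Z.
  have [|x [y [nz xyE hx hy]]] := @small_int_solution N a b `|r|%N cop aN' bN.
    lia.
  exists x, y; split=> //; rewrite xyE -rE; congr (modz _ _); lia.
have [|x [y [nz xyE hx hy]]] := @small_int_solution N a b `|p%:Z - r|%N cop aN' bN.
  lia.
exists (- x), (- y); split; [|rewrite -rE|lia|lia].
  by move=> [xE yE]; apply: nz; congr (_, _); lia.
have -> : a%:Z * - x + b%:Z * - y = r - p%:Z.
  by have := xyE; rewrite gez0_abs; [lia|lia].
by rewrite -[X in r - X]mul1r -mulNr addrC modzMDl.
Qed.

End Congruence.

(** * Counting coprime pairs *)

Section Counting.
Local Open Scope nat_scope.

(** The element [i] of ['I_N] stands for the integer [i + 1] of [[1, N]]. *)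
Definition multiples (N d : nat) : {set 'I_N} := [set i : 'I_N | d %| i.+1].

Lemma card_multiples N d : #|multiples N d| = N %/ d.
Proof.
rewrite divn_count_dvd big_add1 /= big_mkord -sum1_card big_mkcond /=.
by apply: eq_bigr => i _; rewrite inE; case: ifP.
Qed.

Definition coprime_pairs (N : nat) : {set 'I_N * 'I_N} :=
  [set ij : 'I_N * 'I_N | coprime ij.1.+1 ij.2.+1].

(** A common divisor greater than 1 is even, and then 2 is a common divisor, or
    it is one of 3, 5, 7 and so on.  Letting the divisors run over 2 and all odd
    integers is enough for the constant 1/2 below and avoids sums over primes. *)
Lemma noncoprime_cover N :
  ~: coprime_pairs N \subset
  finset.setX (multiples N 2) (multiples N 2)
  :|: \bigcup_(k < N) finset.setX (multiples N k.*2.+3) (multiples N k.*2.+3).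
Proof.
apply/fintype.subsetP => -[i j]; rewrite !inE /= => ncop.
pose g := gcdn i.+1 j.+1.
have g_gt1 : 1 < g by rewrite ltn_neqAle eq_sym ncop gcdn_gt0.
have gi : g %| i.+1 := dvdn_gcdl _ _.
have gj : g %| j.+1 := dvdn_gcdr _ _.
have [g_odd|g_even] := boolP (odd g); last first.
  have g2 : 2 %| g by rewrite dvdn2.
  by rewrite !(dvdn_trans g2).
apply/orP; right.
have gN : g <= N by apply: leq_trans (ltn_ord i); apply: dvdn_leq.
have kN : (g - 3)./2 < N by lia.
have gE : (g - 3)./2.*2.+3 = g by lia.
apply/bigcupP; exists (Ordinal kN) => //.
by rewrite !inE /= gE gi gj.
Qed.

(** Telescoping: [1 / (2 k + 3) ^ 2] is less than
    [1 / ((2 k + 2) (2 k + 4))], which is a quarter of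
    [1 / (k + 1) - 1 / (k + 2)]. *)
Lemma sum_inv_odd_sq (R : realFieldType) (n : nat) :
  (\sum_(k < n) (k.*2.+3%:R ^- 2) <= 4^-1 - 4^-1 * n.+1%:R^-1 :> R)%R.
Proof.
elim: n => [|n IHn]; first by rewrite big_ord0 invr1 mulr1 subrr.
rewrite big_ord_recr /=; apply: le_trans (lerD IHn (lexx _)) _.
have n0 : (0 <= n%:R :> R)%R by rewrite ler0n.
have -> : (n.*2.+3%:R = 2 * n%:R + 3 :> R)%R by rewrite -addn3 natrD -muln2 natrM mulrC.
rewrite -[n.+2]addn2 -[n.+1]addn1 !natrD.
set x : R := n%:R%R in n0 *.
have : (4^-1 * (x + 1)^-1 - 4^-1 * (x + 2)^-1 - (2 * x + 3)^-2
   = 4^-1 * (x + 1)^-1 * (x + 2)^-1 * (2 * x + 3)^-2)%R.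
  by field; apply/and3P; split; lra.
have : (0 <= 4^-1 * (x + 1)^-1 * (x + 2)^-1 * (2 * x + 3)^-2)%R.
  by rewrite !mulr_ge0 ?invr_ge0 ?exprn_ge0 //; lra.
lra.
Qed.

(** The pairs with common divisor [d] number [(N %/ d) ^ 2], so non-coprime
    pairs make up at most the proportion 1/4 (from [d = 2]) plus 1/4 (from the
    odd [d]) of the square. *)
Lemma card_coprime_pairs N : N ^ 2 <= #|coprime_pairs N|.*2.
Proof.
have sq_div (d : nat) : 0 < d ->
    (((N %/ d) * (N %/ d))%:R <= N%:R ^+ 2 * d%:R ^- 2 :> rat)%R.
  move=> d0; rewrite natrM -expr2 -exprVn -exprMn.
  rewrite lerXn2r ?nnegrE ?ler0n ?mulr_ge0 ?invr_ge0 ?ler0n //.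
  by rewrite ler_pdivlMr ?ltr0n // -natrM ler_nat leq_trunc_div.
have noncop : (#|~: coprime_pairs N|%:R <= N%:R ^+ 2 / 2 :> rat)%R.
  pose even_part : rat := #|finset.setX (multiples N 2) (multiples N 2)|%:R%R.
  pose odd_part : rat :=
    (\sum_(k < N) #|finset.setX (multiples N k.*2.+3) (multiples N k.*2.+3)|%:R)%R.
  have : (#|~: coprime_pairs N|%:R <= even_part + odd_part)%R.
    rewrite /even_part /odd_part -natr_sum -natrD ler_nat.
    apply: leq_trans (subset_leq_card (noncoprime_cover N)) _.
    apply: leq_trans (leq_card_setU _ _) _; rewrite leq_add2l.
    elim/big_rec2: _ => [|k m A _ IH]; first by rewrite cards0.
    by apply: leq_trans (leq_card_setU _ _) _; rewrite leq_add2l.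
  have : (even_part <= N%:R ^+ 2 * 2%:R ^- 2)%R.
    by rewrite /even_part cardsX card_multiples sq_div.
  have : (odd_part <= N%:R ^+ 2 * (\sum_(k < N) (k.*2.+3%:R ^- 2)))%R.
    rewrite mulr_sumr; apply: ler_sum => k _.
    by rewrite cardsX card_multiples sq_div.
  have : (N%:R ^+ 2 * (\sum_(k < N) (k.*2.+3%:R ^- 2)) <= N%:R ^+ 2 / 4 :> rat)%R.
    apply: ler_wpM2l; first by rewrite exprn_ge0 ?ler0n.
    apply: le_trans (sum_inv_odd_sq rat N) _.
    by rewrite gerBl mulr_ge0 ?invr_ge0 ?ler0n.
  lra.
have := cardsC (coprime_pairs N); rewrite card_prod card_ord => cardE.
have : (#|coprime_pairs N|%:R + #|~: coprime_pairs N|%:R = N%:R ^+ 2 :> rat)%R.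
  by rewrite -natrD cardE natrM.
rewrite -(ler_nat rat) -muln2 natrM natrX; lra.
Qed.

(** For the integers [a = i + 1], the condition [N <= 2 i] reads
    [a >= N / 2 + 1], the bound under which the congruence is solved. *)
Definition large_coprime_pairs (N : nat) : {set 'I_N * 'I_N} :=
  [set ij in coprime_pairs N | (N <= ij.1.*2) || (N <= ij.2.*2)].

Lemma card_large_coprime_pairs N :
  N ^ 2 <= (#|large_coprime_pairs N|).*2 + (uphalf N ^ 2).*2.
Proof.
apply: leq_trans (card_coprime_pairs N) _; rewrite -doubleD leq_double.
pose small : {set 'I_N} := [set i : 'I_N | i.*2 < N].
have card_small : #|small| <= uphalf N.
  have hN : uphalf N <= N by lia.
  have sub : small \subset [set widen_ord hN i | i : 'I_(uphalf N)].
    apply/fintype.subsetP => i; rewrite inE => iN.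
    have iN' : i < uphalf N by lia.
    by apply/imsetP; exists (Ordinal iN') => //; apply: val_inj.
  apply: leq_trans (subset_leq_card sub) _.
  by apply: leq_trans (leq_imset_card _ _) _; rewrite card_ord.
have sub : coprime_pairs N \subset large_coprime_pairs N :|: finset.setX small small.
  by apply/fintype.subsetP => -[i j]; rewrite !inE /= => ->; lia.
apply: leq_trans (subset_leq_card sub) _.
apply: leq_trans (leq_card_setU _ _) _.
by rewrite leq_add2l cardsX leq_mul.
Qed.

End Counting.

(** * A lower bound for [pi] *)

Local Open Scope classical_set_scope.
Local Open Scope ring_scope.

Lemma sin_le_id (R : realType) (x : R) : 0 <= x -> sin x <= x.
Proof.
move=> x0.
have [|c _] := @MVT_segment R sin cos 0 x x0.
  exact/continuous_subspaceT/continuous_sin.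
rewrite sin0 !subr0 => ->; rewrite ler_piMl //; exact: cos_le1.
Qed.

(** By the formula for the triple angle, [t = pi / 6] satisfies
    [0 = cos (3 t) = cos t (4 cos t ^ 2 - 3)], and [cos t] is not zero. *)
Lemma cos_pi6_sq (R : realType) : cos (pi / 6 : R) ^+ 2 = 3 / 4.
Proof.
set t : R := pi / 6.
have t0 : 0 < t by rewrite /t; have := pi_gt0 R; lra.
have ct : 0 < cos t.
  by apply: cos_gt0_pihalf; apply/andP; split; rewrite /t in t0 *; lra.
have : cos (t *+ 2 + t) = 0.
  by rewrite -(cos_pihalf R); congr cos; rewrite /t; lra.
rewrite cosD cos_mulr2n sin_mulr2n => h.
have /eqP : cos t * (cos t ^+ 2 *+ 4 - 3) = 0.
  by rewrite -h; have := sin2cos2 t => s2; ring: s2.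
rewrite mulf_eq0 gt_eqF //= => /eqP; lra.
Qed.

(** [48 / 5] is the value of [pi ^ 2] at which [12 / pi ^ 2 - 1] equals 1/4.
    From [sin x <= x] at [x = pi / 12] one gets
    [pi ^ 2 >= 144 sin (pi / 12) ^ 2 = 72 - 36 sqrt 3], about 9.646. *)
Lemma pi_sq_ge (R : realType) : 48 / 5 <= (pi : R) ^+ 2.
Proof.
have p0 := pi_gt0 R.
have s : 0 <= sin (pi / 12 : R).
  by apply: sin_ge0_pi; apply/andP; split; lra.
have sp : sin (pi / 12 : R) <= pi / 12 by apply: sin_le_id; lra.
have cE : cos (pi / 6 : R) = 1 - 2 * sin (pi / 12) ^+ 2.
  have -> : pi / 6 = (pi / 12) *+ 2 :> R by lra.
  by rewrite cos_mulr2n cos2sin2; ring.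
have := cos_pi6_sq R; rewrite cE.
set u := sin _ in s sp *.
have : u ^+ 2 <= (pi / 12) ^+ 2 by rewrite lerXn2r ?nnegrE //; lra.
nra.
Qed.

(** * Counting good pairs *)

Lemma has_small_solutionC (R : realType) (p : nat) (a b c : int) :
  has_small_solution R p a b c -> has_small_solution R p b a c.
Proof.
move=> [x [y [nz xyE hx hy]]]; exists y, x; split=> //.
  by move=> [yE xE]; apply: nz; rewrite xE yE.
by rewrite addrC.
Qed.

Lemma small_solution_of_large (R : realType) (p N a b : nat) (c : int) :
  N%:R <= Num.sqrt p%:R :> R ->
  coprime a b -> (N.+2 <= a.*2)%N -> (a <= N)%N -> (0 < b <= N)%N ->
  (0 < p < N.+1 ^ 2)%N -> has_small_solution R p a b c.
Proof.
move=> Np cop Na aN bN pN.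
have [x [y [nz xyE hx hy]]] := @small_mod_solution p N a b c cop Na aN bN pN.
have le_sqrt (z : int) : `|z| <= N%:Z -> `|z%:~R| <= Num.sqrt p%:R :> R.
  move=> zN; apply: le_trans Np.
  by rewrite -intr_norm [leRHS]pmulrn ler_int.
by exists x, y; split=> //; apply: le_sqrt.
Qed.

Lemma card_good_pairs_ge (R : realType) (p N : nat) :
  N%:R <= Num.sqrt p%:R :> R -> (0 < p < N.+1 ^ 2)%N ->
  (#|large_coprime_pairs N| <= #|` fset_set (good_pairs R p)|)%N.
Proof.
move=> Np pN.
pose f (ij : 'I_N * 'I_N) : int * int := (ij.1.+1%:Z, ij.2.+1%:Z).
have f_inj : injective f.
  by move=> [i j] [k l] [ik jl]; congr (_, _); apply: val_inj.
rewrite cardE -(size_map f) -(undup_id (s := map _ _)); last first.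
  by rewrite map_inj_uniq ?enum_uniq.
rewrite -(card_fseq (map f _)); apply: fsubset_leq_card.
apply/fsubsetP => ab; rewrite inE => /mapP[[i j]]; rewrite mem_enum => ijL ->{ab}.
rewrite in_fset_set; last exact: finite_good_pairs.
rewrite inE /=.
have in_range (k : 'I_N) : 1 <= (k.+1%:~R : R) <= Num.sqrt p%:R.
  rewrite -pmulrn ler1n /= (le_trans _ Np) // ler_nat; exact: ltn_ord.
split=> [||c]; [exact: in_range|exact: in_range|].
have iN := ltn_ord i; have jN := ltn_ord j.
move: ijL; rewrite !inE /= => /andP[cop /orP[large|large]].
  by apply: (@small_solution_of_large R p N) => //; lia.
apply/has_small_solutionC/(@small_solution_of_large R p N) => //.
by rewrite coprime_sym.
Qed.

(** With [N] the integer part of [sqrt p], the coprime pairs number at least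
    [N ^ 2 / 2] and those with both entries below [N / 2 + 1] about
    [N ^ 2 / 4] at most; the remaining ones are good, and [p - N ^ 2 <= 2 N]. *)
Lemma quarter_lower_bound (R : realType) (p : nat) : (0 < p)%N ->
  p%:R / 4 - 2 * Num.sqrt p%:R <= #|` fset_set (good_pairs R p)|%:R :> R.
Proof.
move=> p0; set s : R := Num.sqrt p%:R.
have s1 : 1 <= s by rewrite -sqrtr1 ler_wsqrtr // ler1n.
have s2 : s ^+ 2 = p%:R by rewrite sqr_sqrtr ?ler0n.
have /andP[Ns sN] := truncn_itv (le_trans ler01 s1).
set N := Num.trunc s in Ns sN.
have pN : (0 < p < N.+1 ^ 2)%N.
  rewrite p0 /= -(ltr_nat R) natrX -s2 ltrXn2r ?nnegrE //; lra.
have good := card_good_pairs_ge R p N Ns pN.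
have large := card_large_coprime_pairs N.
apply: (@le_trans _ _ #|large_coprime_pairs N|%:R); last by rewrite ler_nat.
have p_le : (p <= 4 * #|large_coprime_pairs N| + 4 * N + 1)%N.
  have : (2 * uphalf N <= N.+1)%N by lia.
  move: (uphalf N) large => h large hN; nia.
move: p_le; rewrite -(ler_nat R) addn1 -natr1 natrD !natrM; lra.
Qed.

Theorem corollary1p14 (R : realType) :
  exists C : R, 0 < C /\
    forall p : nat, prime p ->
      (12 / pi ^+ 2 - 1) * p%:R
        - C * (p%:R `^ (3 / 4) * ln p%:R `^ (2 `^ (3 / 2) + 1))
      <= #|` fset_set (good_pairs R p)|%:R.
Proof.
set e : R := 2 `^ (3 / 2) + 1.
have e0 : 0 <= e by rewrite addr_ge0 ?powR_ge0.
have ln2 : 0 < ln 2 :> R by rewrite ln_gt0 // ltr1n.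
have K0 : 0 < ln (2 : R) `^ e by rewrite powR_gt0.
exists (2 / ln 2 `^ e); split=> [|p p_prime]; first by rewrite divr_gt0.
have p2 := prime_gt1 p_prime.
apply: le_trans (quarter_lower_bound R p (ltnW p2)).
apply: lerB.
  rewrite mulrC ler_wpM2l ?ler0n // lerBlDr ler_pdivrMr.
    have := pi_sq_ge R; lra.
  by rewrite exprn_gt0 ?pi_gt0.
have p1 : 1 <= p%:R :> R by rewrite ler1n ltnW.
(* The error [2 sqrt p] is absorbed by the power [p `^ (3 / 4)]; the constant
   [2 / ln 2 ^ e] compensates for [ln p] being possibly below 1. *)
have sqrt_le : Num.sqrt p%:R <= p%:R `^ (3 / 4) :> R.
  by rewrite -powR12_sqrt ?ler0n // ler_powR //; lra.
have ln_le : ln 2 `^ e <= ln p%:R `^ e :> R.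
  rewrite ge0_ler_powR ?nnegrE ?ln_ge0 ?ler1n ?(ltnW p2) //.
  by rewrite ler_ln ?posrE ?ltr0n ?ler_nat // ltnW.
rewrite -mulrA ler_pM2l ?ltr0n // mulrCA; apply: le_trans sqrt_le _.
by rewrite ler_peMr ?powR_ge0 // mulrC ler_pdivlMr // mul1r.
Qed.
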